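(* A compact space $X$ is $\mathrm{I}$-favorable if and only if $X$ is quasi $\kappa$-metrizable.
   Context: All topological spaces are Tychonoff and non-empty. $\mathrm{I}$-favorable: $X$ is $\mathrm{I}$-favorable if player I has a winning strategy in the open-open game, i.e. there is a function $\sigma$ assigning to every finite (possibly empty) sequence of non-empty open subsets of $X$ a non-empty open subset of $X$, such that for every sequence $(U_k)_{k\ge 0}$ of non-empty open subsets of $X$ with $U_0\subset\sigma(\varnothing)$ and $U_{k+1}\subset\sigma(U_0,\dots,U_k)$ for all $k\ge 0$, the union $\bigcup_{k\ge 0}U_k$ is dense in $X$. Quasi $\kappa$-metric: a set $C\subset X$ is canonically (regularly) closed if it is the closure of its interior. A quasi $\kappa$-metric on $X$ is a non-negative real-valued function $\rho(x,C)$ of two variables, a point $x\in X$ and a canonically closed set $C\subset X$, such that: K1* ) for any $C$ there is a dense open subset $V$ of $X\setminus C$ such that $\rho(x,C)=0$ iff $x\in X\setminus V$; K2) if $C\subset C'$, then $\rho(x,C')\le\rho(x,C)$ for every $x\in X$; K3) $\rho(x,C)$ is a continuous function of $x$ for every $C$; K4) $\rho(x,\overline{\bigcup_\alpha C_\alpha})=\inf_\alpha\rho(x,C_\alpha)$ for every $x \in X$ and every increasing transfinite family $\{C_\alpha\}$ of canonically closed sets in $X$. $X$ is quasi $\kappa$-metrizable if it admits a quasi $\kappa$-metric. *)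

(* Defs.v *)
From mathcomp Require Import all_boot all_order all_algebra.
From mathcomp Require Import wochoice.
From mathcomp Require Import all_classical all_reals all_analysis.
Import Order.TTheory GRing.Theory Num.Theory.
Import numFieldNormedType.Exports.

Set Implicit Arguments.
Unset Strict Implicit.
Unset Printing Implicit Defensive.

Local Open Scope classical_set_scope.
Local Open Scope ring_scope.

Definition tychonoff_space (X : topologicalType) : Prop :=
  hausdorff_space X /\ completely_regular_space X.

(* The history U_0, ..., U_(k-1) of a play is [mkseq U k]; it is empty for
   k = 0, so the single condition on [U k] covers the opening move as well. *)
Definition I_favorable (X : topologicalType) : Prop :=
  exists sigma : seq (set X) -> set X,
    (forall s : seq (set X),
        (forall U : set X, U \in s -> open U /\ U !=set0) ->
        open (sigma s) /\ sigma s !=set0) /\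
    (forall U : nat -> set X,
        (forall k : nat, open (U k) /\ U k !=set0) ->
        (forall k : nat, U k `<=` sigma (mkseq U k)) ->
        dense (\bigcup_k U k)).

(* Canonically closed sets are the library's [regclosed] sets.  [rho] is total
   on [set X], but only its values on [regclosed] sets are constrained.
   In K1*, since [X \ C] is open, V is open in it when it is open in X, and V
   is dense in it when the closure of V in X contains it.
   In K4, a transfinite family is one indexed by a non-empty well-ordered type;
   it is non-strictly increasing. *)
Record is_quasi_kappa_metric (R : realType) (X : topologicalType)
    (rho : X -> set X -> R) : Prop := {
  qkm_ge0 : forall (x : X) (C : set X), regclosed C -> 0 <= rho x C;
  qkm_K1 : forall C : set X, regclosed C ->
    exists V : set X,
      [/\ open V, V `<=` ~` C, ~` C `<=` closure V &
          forall x : X, rho x C = 0 <-> (~` V) x];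
  qkm_K2 : forall C C' : set X, regclosed C -> regclosed C' ->
    C `<=` C' -> forall x : X, rho x C' <= rho x C;
  qkm_K3 : forall C : set X, regclosed C ->
    continuous (fun x : X => rho x C);
  qkm_K4 : forall (I : Type) (le_I : rel I) (C : I -> set X),
    inhabited I -> well_order le_I ->
    (forall i : I, regclosed (C i)) ->
    (forall i j : I, le_I i j -> C i `<=` C j) ->
    forall x : X,
      rho x (closure (\bigcup_i C i)) = inf (range (fun i : I => rho x (C i)))
}.

Definition quasi_kappa_metrizable (R : realType) (X : topologicalType) : Prop :=
  exists rho : X -> set X -> R, is_quasi_kappa_metric rho.

(* Main.v *)
Require Import Defs.
From mathcomp Require Import all_boot all_order all_algebra.
From mathcomp Require Import wochoice.
From mathcomp Require Import all_classical all_reals all_analysis.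
From mathcomp Require Import lra.
Import Order.TTheory GRing.Theory Num.Theory.
Import numFieldNormedType.Exports.

(** The two implications are independent. Both use compactness through
    Dini's theorem: a decreasing family of continuous functions with a
    continuous infimum converges uniformly.

    _From a metric to a strategy_ ([quasi_kappa_I_favorable]). Let [D] be the
    closure of the union of the sets played so far. Player I plays
    [{x | rho x D > 1/(n+1)}] for the least [n] making this set non-empty. If
    the closure [G] of the union of the whole play were not the space,
    [rho x0 G > 1/(N+1)] for some [x0] and [N]; by K2 player I then always uses
    an [n <= N]. By K4 and Dini, [rho _ D] tends uniformly to [rho _ G], so
    late in the play player I plays inside [{x | rho x G > 0}], which misses
    [G]; but player II answers inside the set played, hence inside [G].

    _From a strategy to a metric_ ([I_favorable_metrizes]). Consider families
    of cozero sets closed under the strategy, under non-empty binary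
    intersections and under level sets of a chosen bump function for each
    cozero set. Such a family [N] has projections ([op_closed_proj]): each
    non-empty open [W] has some [w] in [N] such that every member of [N] below
    [w] meets [W]. Otherwise player II could answer inside [N] and outside [W]
    for ever, and win. A metric for [N] is a function satisfying
    K2, K3, K4 and vanishing on the set, which is asked to be positive only
    near the members of [N] that miss the set ([metrizes]). For countable [N]
    a weighted supremum of bump functions is such a metric
    ([countable_metrizes]); the theorem needs one for the family of all cozero
    sets.

    That family is exhausted by transfinite induction along a well-order of
    the subsets of the space. Let [N(F, J)] be the family generated by a finite [F] and an
    initial segment [J]. As [N(F, {c <= b})] is also [N(b :: F, {c < b})], a
    statement about all finite [F] provides metrics [phi_b] for all the
    [N(F, {c <= b})] with [b] in [J], and it remains to glue them. If [r] is
    the glued metric already built for [N(F, {c < b})], put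
      [corr_b x U = min (phi_b x U, 1/2 sup_s min (s, r x (lower s U)))],
    where [lower s U] is the union of the members of [N(F, {c < b})] that miss
    every member of [N(F, {c <= b})] contained in the level set
    [{phi_b _ U > s}]. The glued metric for [J] is the supremum of a metric for
    [N(F, set0)] and of all [corr_b] with [b] in [J].

    Two facts make this work. First, [corr_b _ U] depends on [U] only through
    the level sets of [phi_b _ U], in a way that is 1-Lipschitz for uniform
    distance; so K4 for [phi_b], uniform by Dini, gives K4 for [corr_b]
    ([kappa_like_correction]). Secondly, although the supremum is infinite, for
    a dense supply of open sets [U] all but finitely many [b] see [U] as a
    member of [N(F, {c < b})] ([stable_dense]), and for these
    [corr_b x C <= 1/2 r x U] as soon as [U] lies in [C]. The factor 1/2 makes
    a contraction: if [g] is the infimum of [r x V] over the good open sets [V]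
    inside [C], then [g <= max (r x C, g / 2)], so [g <= r x C]
    ([kappa_like_ksup]). *)

Set Implicit Arguments.
Unset Strict Implicit.
Unset Printing Implicit Defensive.

Local Open Scope classical_set_scope.
Local Open Scope ring_scope.

(** * Open sets, semicontinuity and directed families *)

Section Topology.
Context {X : topologicalType}.

Lemma openP (A : set X) :
  (forall x, A x -> exists2 O, open O /\ O x & O `<=` A) -> open A.
Proof.
move=> h; rewrite openE => x /h [G [oG Gx] GA].
by rewrite /interior nbhsE; exists G.
Qed.

Lemma closure_meets (A O : set X) :
  open O -> O `&` closure A !=set0 -> O `&` A !=set0.
Proof.
move=> oO [x [Ox clAx]].
by have [y [Ay Oy]] := clAx O (open_nbhs_nbhs (conj oO Ox)); exists y.
Qed.

Lemma meets_closure (A B : set X) :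
  (forall O, open O -> O `&` B !=set0 -> O `&` A !=set0) -> B `<=` closure A.
Proof.
move=> h x Bx N; rewrite nbhsE => -[G [oG Gx] GN].
have [|y [Oy Ay]] := h G oG; first by exists x.
by exists y; split=> //; exact: GN.
Qed.

Lemma open_all_seq (I : eqType) (L : seq I) (P : I -> set X) :
  (forall i, i \in L -> open (P i)) -> open [set x | forall i, i \in L -> P i x].
Proof.
elim: L => [|i L IH] oP.
  by rewrite (_ : [set x | _] = setT); [exact: openT|apply/seteqP; split=> x].
rewrite (_ : [set x | _] = P i `&` [set x | forall i, i \in L -> P i x]).
  apply: openI; first by apply: oP; rewrite mem_head.
  by apply: IH => j jL; apply: oP; rewrite inE jL orbT.
apply/seteqP; split => x.
  move=> h; split; first by apply: h; rewrite mem_head.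
  by move=> j jL; apply: h; rewrite inE jL orbT.
by move=> [Pi h] j; rewrite inE => /orP [/eqP ->|/h].
Qed.

Lemma continuous_rays {R : realType} (f : X -> R) :
  continuous f <->
  forall t, open [set x | t < f x] /\ open [set x | f x < t].
Proof.
split=> [cf t|h x].
  split; [apply: (open_comp (f := f) (D := [set y | t < y])) |
          apply: (open_comp (f := f) (D := [set y | y < t]))];
    by [move=> y _; exact: cf|exact: open_gt|exact: open_lt].
apply/cvgrPdist_lt => e e0.
have [og _] := h (f x - e); have [_ ol] := h (f x + e).
have nx : nbhs x ([set y | f x - e < f y] `&` [set y | f y < f x + e]).
  apply: open_nbhs_nbhs; split; first exact: openI.
  by split => /=; lra.
by apply: filterS nx => y /= [h1 h2]; rewrite ltr_norml; apply/andP; split; lra.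
Qed.

Definition directed (UU : set (set X)) :=
  UU !=set0 /\
  forall U V, UU U -> UU V -> exists2 W, UU W & U `|` V `<=` W.

(** A directed family has a member beyond [U0] that satisfies finitely many
    monotone requirements at once. *)
Lemma directed_bound (I : eqType) (UU : set (set X)) (P : I -> set X -> Prop)
    (L : seq I) U0 :
  directed UU -> UU U0 ->
  (forall i U V, UU U -> UU V -> P i U -> U `<=` V -> P i V) ->
  (forall i, i \in L -> exists2 U, UU U & P i U) ->
  exists2 U, UU U & U0 `<=` U /\ forall i, i \in L -> P i U.
Proof.
move=> [_ dir] UU0 mono; elim: L => [|i L IH] h; first by exists U0; [|split].
have [|U UUU [U0U PU]] := IH; first by move=> j jL; apply: h; rewrite inE jL orbT.
have [V UUV PV] := h i (mem_head i L).
have [W UUW UVW] := dir _ _ UUU UUV.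
exists W => //; split; first by move=> x /U0U Ux; apply: UVW; left.
move=> j; rewrite inE => /orP [/eqP ->|jL].
  by apply: (mono _ _ _ UUV UUW PV) => x Vx; apply: UVW; right.
by apply: (mono _ _ _ UUU UUW (PU j jL)) => x Ux; apply: UVW; left.
Qed.

End Topology.

Lemma sup01_ub {R : realType} (A : set R) y : (forall z, A z -> z <= 1) -> A y -> y <= sup A.
Proof. by move=> h Ay; apply: ub_le_sup => //; exists 1 => z /h. Qed.

(** * Functions of a point and an open set with the properties K2, K3, K4 *)

Section KappaLike.
Context {R : realType} {X : topologicalType}.

(** The open set [U] stands for the canonically closed set [closure U];
    [kl_anti] with [closure V] on the right makes the value depend on that
    closure only. Continuity is split into its two semicontinuous halves, which
    are proved by different arguments for suprema. K4 is asked for directed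
    families, because the family of good open subsets of an open set, used for
    suprema, is directed but not well-ordered. The condition [kl_zero] is the
    half of K1 that is stable under all constructions. *)
Record kappa_like (c : X -> set X -> R) : Prop := KappaLike {
  kl_ge0 : forall x U, 0 <= c x U;
  kl_le1 : forall x U, c x U <= 1;
  kl_anti : forall U V, open U -> open V -> U `<=` closure V ->
    forall x, c x V <= c x U;
  kl_cont : forall U, open U ->
    forall t, open [set x | t < c x U] /\ open [set x | c x U < t];
  kl_dir : forall UU, directed UU -> (forall U, UU U -> open U) ->
    forall x e, 0 < e ->
    exists2 V, UU V & c x V < c x (\bigcup_(U in UU) U) + e;
  kl_zero : forall U x, open U -> U x -> c x U = 0
}.

Lemma kl_antiS (c : X -> set X -> R) (U V : set X) x :
  kappa_like c -> open U -> open V -> U `<=` V -> c x V <= c x U.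
Proof.
by move=> kc oU oV UV; apply: kl_anti => // y /UV; exact: subset_closure.
Qed.

(** Dini's theorem for [kl_dir]: compactness makes the choice of [V] uniform in
    the point. *)
Lemma kl_dini (c : X -> set X -> R) (UU : set (set X)) e :
  compact [set: X] -> kappa_like c ->
  directed UU -> (forall U, UU U -> open U) -> 0 < e ->
  exists2 V, UU V & forall x, c x V <= c x (\bigcup_(U in UU) U) + e.
Proof.
move=> cptX kc dir oUU e0; set W := \bigcup_(U in UU) U.
have oW : open W by exact: bigcup_open.
pose F : set_system (set X) :=
  [set A | exists2 V, UU V & forall V', UU V' -> V `<=` V' -> A V'].
have FF : Filter F.
  split.
  - by have [[V UV] _] := dir; exists V.
  - move=> A B [V UV hV] [V' UV' hV'].
    have [Z UZ VZ] := dir.2 _ _ UV UV'.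
    exists Z => // Y UY ZY; split.
      by apply: hV => // y Vy; apply/ZY/VZ; left.
    by apply: hV' => // y Vy; apply/ZY/VZ; right.
  - by move=> A B AB [V UV hV]; exists V => // V' UV' /(hV _ UV')/AB.
have cov : forall x, [set: X] x ->
    \forall x' \near x & V \near F, UU V -> c x' V <= c x' W + e.
  move=> x _.
  have e20 : 0 < e / 2 by rewrite divr_gt0.
  have [V UV cV] := kl_dir kc dir oUU x e20.
  have [_ oV] := kl_cont kc (oUU _ UV) (c x W + 3 * e / 4).
  have [oW' _] := kl_cont kc oW (c x W - e / 4).
  exists ([set y | c y V < c x W + 3 * e / 4] `&` [set y | c x W - e / 4 < c y W],
          [set V' | V `<=` V']) => /=.
    split.
      apply: open_nbhs_nbhs; split; first exact: openI.
      by rewrite -/W in cV; split => /=; lra.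
    by exists V.
  move=> [y V'] /= [[h1 h2] h3] UV'.
  have h4 := kl_antiS y kc (oUU _ UV) (oUU _ UV') h3.
  by apply: (le_trans h4); lra.
have [V UV hV] := (compact_near_coveringP [set: X]).1 cptX _ F _ FF cov.
by exists V => // x; apply: hV.
Qed.

End KappaLike.

(** * Suprema of infinitely many such functions *)

Section Supremum.
Context {R : realType} {X : topologicalType} {I : eqType}.
Variables (D : set I) (c : I -> X -> set X -> R).
Hypothesis D0 : D !=set0.
Hypothesis kc : forall i, D i -> kappa_like (c i).

Definition ksup (x : X) (U : set X) : R := sup [set c i x U | i in D].

(** [S i U] is to mean that [c i] has nothing of its own to say about sets
    containing [U]: its values there are at most half of the supremum at [U].
    The error [e] makes room for functions [c i] that are small outright. *)
Hypothesis tame : forall e : R, 0 < e -> exists S : I -> set X -> Prop,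
  [/\ exists L : seq I, forall i, D i -> i \notin L -> S i set0,
      forall i U V, S i U -> S i V -> S i (U `|` V),
      forall W, open W -> W !=set0 -> exists U (L : seq I),
        [/\ open U, U !=set0, U `<=` W & forall i, D i -> i \notin L -> S i U]
    & forall i U C x, D i -> open U -> open C -> S i U -> U `<=` C ->
        c i x C <= ksup x U / 2 + e].

Lemma ksup_ub i x U : D i -> c i x U <= ksup x U.
Proof.
move=> Di; apply: sup01_ub; last by exists i.
by move=> _ [j Dj <-]; exact: kl_le1 (kc Dj) _ _.
Qed.

Lemma ksup_le x U t : (forall i, D i -> c i x U <= t) -> ksup x U <= t.
Proof.
move=> h; apply: ge_sup; last by move=> _ [i Di <-]; exact: h.
by have [i Di] := D0; exists (c i x U), i.
Qed.

Lemma ksup_gt x U t : t < ksup x U -> exists2 i, D i & t < c i x U.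
Proof.
move=> /sup_gt [|_ [i Di <-] ti]; last by exists i.
by have [i Di] := D0; exists (c i x U), i.
Qed.

Lemma ksup_ge0 x U : 0 <= ksup x U.
Proof.
have [i Di] := D0.
exact: le_trans (kl_ge0 (kc Di) x U) (ksup_ub x U Di).
Qed.

Lemma ksup_anti U V : open U -> open V -> U `<=` closure V ->
  forall x, ksup x V <= ksup x U.
Proof.
move=> oU oV UV x; apply: ksup_le => i Di.
exact: le_trans (kl_anti (kc Di) oU oV UV x) (ksup_ub x U Di).
Qed.

(** Unions of good sets, each inside one member of [UU]. They exhaust
    [\bigcup_(U in UU) U] only up to closure, and this is why [kl_anti] is
    stated with a closure. *)
Definition tame_below (S : I -> set X -> Prop) (UU : set (set X)) : set (set X) :=
  [set V | [/\ open V, (exists2 U, UU U & V `<=` U) &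
     exists L : seq I, forall i, D i -> i \notin L -> S i V]].

(** With [g] the infimum of [ksup x V] over the good sets [V] below [UU]: pick
    [V] nearly realizing [g], and a larger good [V'] for which the finitely many
    indices exceptional for [V] are already close to their value at the union.
    The other indices are at most [ksup x V / 2 + e], so [g] is at most the
    value at the union, or at most about [g / 2] and therefore small. *)
Lemma ksup_dir_gen e : 0 < e -> exists S : I -> set X -> Prop,
  (forall i U C x, D i -> open U -> open C -> S i U -> U `<=` C ->
        c i x C <= ksup x U / 2 + e) /\
  forall UU, directed UU -> (forall U, UU U -> open U) ->
  forall x, exists2 V, tame_below S UU V &
    ksup x V <= Num.max (ksup x (\bigcup_(U in UU) U) + e) (3 * e).
Proof.
move=> e0; have [S [S0 SU Sdense Sbound]] := tame e0.
exists S; split=> // UU dirUU oUU x.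
set W := \bigcup_(U in UU) U; pose VV := tame_below S UU.
have oW : open W by exact: bigcup_open.
have oVV V : VV V -> open V by case.
have dirVV : directed VV.
  split.
    have [[U UUU] _] := dirUU; exists set0; split; first exact: open0.
      by exists U.
    exact: S0.
  move=> V1 V2 [oV1 [U1 UU1 VU1] [L1 h1]] [oV2 [U2 UU2 VU2] [L2 h2]].
  exists (V1 `|` V2) => //; split; first exact: openU.
    have [U UUU UU12] := dirUU.2 _ _ UU1 UU2; exists U => // y Vy.
    by apply: UU12; case: Vy => [/VU1|/VU2]; [left|right].
  exists (L1 ++ L2) => i Di; rewrite mem_cat negb_or => /andP [i1 i2].
  by apply: SU; [exact: h1|exact: h2].
have oVVU : open (\bigcup_(V in VV) V) by exact: bigcup_open.
have WVV : W `<=` closure (\bigcup_(V in VV) V).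
  apply: meets_closure => N oN [y [Ny [U UUU Uy]]].
  have [||V [L [oV [z Vz] VNU hL]]] := Sdense (N `&` U).
  - by apply: openI => //; exact: oUU.
  - by exists y.
  exists z; split; first by case: (VNU _ Vz).
  exists V => //; split=> //; last by exists L.
  by exists U => // w /VNU [].
pose T := [set ksup x V | V in VV].
have T0 : T !=set0 by have [[V VVV] _] := dirVV; exists (ksup x V), V.
have lbT : has_lbound T by exists 0 => _ [V _ <-]; exact: ksup_ge0.
have [|_ [V VVV <-] Vinf] := @inf_lt _ T (inf T + e) T0; first by rewrite ltrDl.
have [oV [U UUU VU] [L hL]] := VVV.
pose P i V' := D i -> c i x V' <= c i x (\bigcup_(V in VV) V) + e.
have [||V' VVV' [VV' hV']] := @directed_bound _ _ VV P L V dirVV VVV.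
- move=> i V1 V2 VV1 VV2 P1 V12 Di; apply: le_trans (P1 Di).
  by apply: (kl_antiS x (kc Di)) => //; exact: oVV.
- move=> i _; have [Di|nDi] := pselect (D i); last by exists V => // /nDi.
  have [V' VV' /ltW] := kl_dir (kc Di) dirVV oVV x e0.
  by exists V'.
exists V' => //.
have infV' : inf T <= ksup x V' by apply: ge_inf => //; exists V'.
rewrite le_max; apply/orP.
have [|h] := leP (ksup x V') (ksup x W + e); [by left|right].
have : ksup x V' <= Num.max (ksup x W + e) (ksup x V / 2 + e).
  apply: ksup_le => i Di; rewrite le_max; apply/orP.
  have [iL|iL] := boolP (i \in L).
    left; apply: le_trans (hV' _ iL Di) _; rewrite lerD2r.
    apply: le_trans (ksup_ub x W Di).
    exact: (kl_anti (kc Di)).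
  right; apply: (Sbound i V V' x) => //; [exact: oVV|exact: hL].
rewrite le_max => /orP [|h2]; lra.
Qed.

Lemma kappa_like_ksup : kappa_like ksup.
Proof.
split.
- exact: ksup_ge0.
- by move=> x U; apply: ksup_le => i Di; exact: kl_le1 (kc Di) _ _.
- exact: ksup_anti.
- move=> C oC t; split.
    apply: openP => x /= /ksup_gt [i Di ti].
    have [oi _] := kl_cont (kc Di) oC t.
    exists [set y | t < c i y C] => // y /= /lt_le_trans; apply.
    exact: ksup_ub.
  apply: openP => x /= xt.
  have k0 := ksup_ge0 x C.
  have t0 : 0 < t by exact: le_lt_trans k0 xt.
  (* [ksup _ C] is bounded above near [x] by [ksup _ V], and this in turn by
     finitely many continuous functions, since its other terms are at most half
     of it, up to [e]. *)
  pose e := Num.min ((t - ksup x C) / 2) (t / 8).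
  have e0 : 0 < e by rewrite lt_min !divr_gt0 // subr_gt0.
  have [e1 e2] : e <= (t - ksup x C) / 2 /\ e <= t / 8.
    by split; rewrite ge_min lexx ?orbT.
  have [S [Sbound Sdir]] := ksup_dir_gen e0.
  have dC : directed [set C] by split; [exists C|move=> U V -> ->; exists C => //; rewrite setUid].
  have [|V [oV [_ -> VC] [L hL]]] := Sdir _ dC _ x; first by move=> U ->.
  rewrite bigcup_set1 => hV.
  have {hV} hV : ksup x V < (ksup x C + t) / 2 + e / 4.
    apply: le_lt_trans hV _; rewrite gt_max; apply/andP; split; lra.
  pose t' := (ksup x C + t) / 2 + e / 4.
  have t't : t' < t by rewrite /t'; lra.
  exists [set y | forall i, i \in L -> D i -> c i y V < t'].
    split; last by move=> i _ Di; apply: le_lt_trans hV; exact: ksup_ub.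
    apply: (@open_all_seq _ _ L (fun i => [set y | D i -> c i y V < t'])) => i _.
    have [Di|nDi] := pselect (D i).
      have [_] := kl_cont (kc Di) oV t'; congr (open _).
      by apply/seteqP; split=> y /=; [move=> h _|apply].
    by rewrite (_ : [set y | _] = setT); [exact: openT|apply/seteqP; split=> y // _ /nDi].
  move=> y /= hy; have yVC : ksup y C <= ksup y V.
    by apply: ksup_anti => // z /VC; exact: subset_closure.
  apply: le_lt_trans yVC _.
  have : ksup y V <= Num.max t' (ksup y V / 2 + e).
    apply: ksup_le => i Di; rewrite le_max; apply/orP.
    have [iL|iL] := boolP (i \in L); first by left; apply/ltW/hy.
    by right; apply: Sbound => //; exact: hL.
  rewrite le_max => /orP [|]; lra.
- move=> UU dirUU oUU x e e0.
  have e30 : 0 < e / 6 by rewrite divr_gt0.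
  have [S [_ Sdir]] := ksup_dir_gen e30.
  have [V [oV [U UUU VU] _] hV] := Sdir _ dirUU oUU x.
  exists U => //; apply: le_lt_trans (_ : ksup x V < _).
    by apply: ksup_anti; [exact: oV|exact: oUU|move=> y /VU; exact: subset_closure].
  have W0 := ksup_ge0 x (\bigcup_(U in UU) U).
  apply: le_lt_trans hV _; rewrite gt_max; apply/andP; split; lra.
- move=> U x oU Ux; apply/eqP; rewrite eq_le ksup_ge0 andbT.
  by apply: ksup_le => i Di; rewrite (kl_zero (kc Di)).
Qed.

End Supremum.

(** * Correcting a metric by a metric for a smaller family *)

Section Refinement.
Context {R : realType} {X : topologicalType}.

(** The other half of K1, tested only on members of [N]; the lower bound [s] on
    a whole member of [N] lets the property be used again at the next stage. *)
Definition separates (c : X -> set X -> R) (N : set (set X)) :=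
  forall W w C, open W -> W !=set0 -> W `<=` w -> N w -> open C ->
    w `&` C = set0 ->
  exists s, 0 < s /\ exists v, [/\ N v, v `&` W !=set0 &
    forall x, v x -> s < c x C].

Definition inter_closed (N : set (set X)) :=
  forall A B, N A -> N B -> A `&` B !=set0 -> N (A `&` B).

(** The set [w] plays the role of the image of [W] under a skeletal map onto
    the quotient of the space determined by [N]. *)
Definition projective (N : set (set X)) :=
  forall W, open W -> W !=set0 ->
  exists2 w, N w & forall v, N v -> v `<=` w -> v `&` W !=set0.

(** [U] looks to [N'] like a union of members of [N]: whatever in [N'] misses
    [U] also misses sets of [N] that cover [U]. *)
Definition stable (N N' : set (set X)) (U : set X) :=
  U `<=` \bigcup_(u in [set u | N u /\
    forall v, N' v -> v `&` U = set0 -> u `&` v = set0]) u.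

Lemma stableU N N' U V : stable N N' U -> stable N N' V -> stable N N' (U `|` V).
Proof.
have sub W v : W `<=` U `|` V -> v `&` (U `|` V) = set0 -> v `&` W = set0.
  by move=> WUV vUV; rewrite -subset0 -vUV; exact: setIS.
move=> sU sV x [/sU|/sV] [u [Nu hu] ux]; exists u => //; split=> // v N'v vUV.
  by apply: hu => //; apply: sub vUV; exact: subsetUl.
by apply: hu => //; apply: sub vUV; exact: subsetUr.
Qed.

(** Below, [r] is a metric for [N], [phi] one for the larger [N'], and
    [correction] adds to [r] the information in [phi]. *)
Variables (N N' : set (set X)) (phi r : X -> set X -> R).
Hypothesis cptX : compact [set: X].
Hypotheses (kphi : kappa_like phi) (kr : kappa_like r).
Hypotheses (oN : forall u, N u -> open u) (oN' : forall u, N' u -> open u).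

(** Up to closure, the complement of the projection to [N] of the level set
    [{phi _ U > s}]. *)
Definition lower (s : R) (U : set X) : set X :=
  \bigcup_(u in [set u | N u /\
    forall v, N' v -> v `<=` [set x | s < phi x U] -> u `&` v = set0]) u.

(** This function measures how far [x] is, in the sense of [r], from the
    complement of the projection of the level set of [phi _ U] above [s]. Taking
    the minimum with [s] and the supremum over [s] makes it insensitive to small
    changes of [phi]. *)
Definition transfer (x : X) (U : set X) : R :=
  sup [set Num.min s (r x (lower s U)) | s in [set s | 0 < s <= 1]].

Definition correction (x : X) (U : set X) : R := Num.min (phi x U) (transfer x U / 2).

Lemma open_lower s U : open (lower s U).
Proof. by apply: bigcup_open => u [/oN]. Qed.

Lemma transfer_ub s x U : 0 < s <= 1 -> Num.min s (r x (lower s U)) <= transfer x U.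
Proof.
move=> s01; apply: sup01_ub; last by exists s.
by move=> _ [t /andP [_ t1] <-]; rewrite ge_min t1.
Qed.

Lemma transfer_le x U t :
  (forall s, 0 < s <= 1 -> Num.min s (r x (lower s U)) <= t) -> transfer x U <= t.
Proof.
move=> h; apply: ge_sup; last by move=> _ [s s01 <-]; exact: h.
by exists (Num.min 1 (r x (lower 1 U))), 1 => //=; rewrite ltr01 lexx.
Qed.

Lemma transfer_gt x U t : t < transfer x U ->
  exists2 s, 0 < s <= 1 & t < Num.min s (r x (lower s U)).
Proof.
move=> /sup_gt [|_ [s s01 <-] ts]; last by exists s.
by exists (Num.min 1 (r x (lower 1 U))), 1 => //=; rewrite ltr01 lexx.
Qed.

Lemma transfer_le1 x U : transfer x U <= 1.
Proof. by apply: transfer_le => s /andP [_ s1]; rewrite ge_min s1. Qed.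

Lemma transfer_ge0 x U : 0 <= transfer x U.
Proof.
have h : 0 < (1 : R) <= 1 by rewrite ltr01 lexx.
by apply: le_trans (transfer_ub x U h); rewrite le_min ler01 (kl_ge0 kr).
Qed.

Lemma lowerS s t U V :
  (forall x, t < phi x V -> s < phi x U) -> lower s U `<=` lower t V.
Proof.
move=> h x [u [Nu hu] ux]; exists u => //; split=> // v N'v vV.
by apply: hu => // y /vV /h.
Qed.

(** A uniform perturbation of [phi] by [e] shifts its level sets by [e], and the
    supremum over [s] absorbs the shift. *)
Lemma transfer_lip e U V : 0 <= e -> (forall x, phi x U <= phi x V + e) ->
  forall x, transfer x U <= transfer x V + e.
Proof.
move=> e0 h x; apply: transfer_le => s /andP [s0 s1].
have V0 := transfer_ge0 x V.
have [se|es] := leP s e; first by rewrite ge_min; apply/orP; left; lra.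
have h' : 0 < s - e <= 1 by apply/andP; split; lra.
have := transfer_ub x V h'.
have : r x (lower s U) <= r x (lower (s - e) V).
  apply: (kl_antiS x kr); try exact: open_lower.
  by apply: lowerS => y sy; have := h y; lra.
rewrite ge_min => h1 /orP [h2|h2]; rewrite ge_min; apply/orP; [left|right]; lra.
Qed.

Lemma transfer_anti U V : (forall x, phi x U <= phi x V) ->
  forall x, transfer x U <= transfer x V.
Proof.
move=> h x; rewrite -[leRHS]addr0; apply: transfer_lip => // y.
by rewrite addr0.
Qed.

Lemma transfer_cont U t : open [set x | t < transfer x U] /\ open [set x | transfer x U < t].
Proof.
split; apply: openP => x /=.
  move=> /transfer_gt [s s01]; rewrite lt_min => /andP [ts tr].
  have [os _] := kl_cont kr (open_lower s U) t.
  exists [set y | t < r y (lower s U)] => // y /= ty.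
  by apply: lt_le_trans (transfer_ub y U s01); rewrite lt_min ts.
move=> xt; have [t1|t1] := ltP 1 t.
  by exists setT; [split; [exact: openT|]|move=> y _ /=; exact: le_lt_trans (transfer_le1 y U) t1].
have x0 := transfer_ge0 x U.
(* At the level [t'] the term [r x (lower t' U)] must be the one below [t'];
   it bounds the terms of all higher levels, and lower levels are below [t']. *)
pose t' := (transfer x U + t) / 2.
have t'01 : 0 < t' <= 1 by rewrite /t'; apply/andP; split; lra.
have rx : r x (lower t' U) < t'.
  have := transfer_ub x U t'01.
  by rewrite ge_min => /orP [|]; rewrite /t'; lra.
have [_ os] := kl_cont kr (open_lower t' U) t'.
exists [set y | r y (lower t' U) < t'] => // y /= yt.
apply: le_lt_trans (_ : t' < t); last by rewrite /t'; lra.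
apply: transfer_le => s s01; rewrite ge_min; have [//|t's] := leP s t'.
apply/orP; right; apply: le_trans (ltW yt).
apply: (kl_antiS y kr); try exact: open_lower.
by apply: lowerS => z; exact: lt_trans.
Qed.

Lemma kappa_like_correction : kappa_like correction.
Proof.
split.
- by move=> x U; rewrite le_min (kl_ge0 kphi) divr_ge0 // transfer_ge0.
- by move=> x U; rewrite ge_min (kl_le1 kphi).
- move=> U V oU oV UV x.
  have h : forall y, phi y V <= phi y U by exact: (kl_anti kphi).
  rewrite le_min; apply/andP; split; rewrite ge_min; first by rewrite h.
  by apply/orP; right; rewrite ler_pM2r ?invr_gt0 //; exact: transfer_anti.
- move=> U oU t.
  have [p1 p2] := kl_cont kphi oU t; have [q1 q2] := transfer_cont U (2 * t).
  rewrite [X in open X /\ _](_ : _ =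
    [set x | t < phi x U] `&` [set x | 2 * t < transfer x U]); last first.
    apply/seteqP; split=> x /=; rewrite lt_min.
      by move=> /andP [? ?]; split=> //; lra.
    by move=> [? ?]; apply/andP; split=> //; lra.
  rewrite [X in _ /\ open X](_ : _ =
    [set x | phi x U < t] `|` [set x | transfer x U < 2 * t]); last first.
    apply/seteqP; split=> x /=; rewrite gt_min.
      by move=> /orP [?|?]; [left|right; lra].
    by move=> [?|?]; apply/orP; [left|right; lra].
  by split; [exact: openI|exact: openU].
- move=> UU dirUU oUU x e e0.
  have e20 : 0 < e / 2 by rewrite divr_gt0.
  have [V VUU hV] := kl_dini cptX kphi dirUU oUU e20.
  exists V => //; have h1 := hV x; have h2 := transfer_lip (ltW e20) hV x.
  rewrite /correction; set W := \bigcup_(U in UU) U in h1 h2 *.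
  have [h|h] := leP (phi x W) (transfer x W / 2); rewrite gt_min; apply/orP;
    [left|right]; lra.
- move=> U x oU Ux; apply/eqP; rewrite eq_le le_min ge_min.
  by rewrite (kl_zero kphi) // lexx divr_ge0 // transfer_ge0.
Qed.

(** Level sets of [phi _ C] above [s > 0] miss [C], hence [U]; stability of [U]
    then puts [U] inside [lower s C]. The factor 1/2 is the one used for suprema. *)
Lemma correction_stable U C x : open U -> open C -> stable N N' U -> U `<=` C ->
  correction x C <= r x U / 2.
Proof.
move=> oU oC sU UC; rewrite ge_min; apply/orP; right.
rewrite ler_pM2r ?invr_gt0 //; apply: transfer_le => s /andP [s0 _].
rewrite ge_min; apply/orP; right; apply: (kl_antiS x kr) => //.
  exact: open_lower.
move=> y /sU [u [Nu hu] uy]; exists u => //; split=> // v N'v vs.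
apply: hu => //; rewrite -subset0 => z [/vs /= sz /UC Cz].
by move: sz; rewrite (kl_zero kphi) // => /(lt_trans s0); rewrite ltxx.
Qed.

(** First use [phi] to find [v1] in [N'] on which [phi _ C] exceeds [s].
    A projection [w1] to [N] of [W `&` v1] is disjoint from [lower s C], so [r] can
    separate it from there on some [v2] in [N]; the set [v1 `&` v2] works. *)
Lemma correction_separates : N `<=` N' -> inter_closed N -> inter_closed N' ->
  projective N -> separates phi N' -> separates r N -> separates correction N'.
Proof.
move=> NN' mN mN' pN sphi sr W w C oW W0 Ww N'w oC wC.
have [s0 [s00 [v1 [N'v1 v1W hv1]]]] := sphi W w C oW W0 Ww N'w oC wC.
pose s := Num.min s0 1.
have s01 : 0 < s <= 1 by rewrite lt_min s00 ltr01 ge_min lexx orbT.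
have sphi1 x : v1 x -> s < phi x C.
  by move=> /hv1; apply: le_lt_trans; rewrite ge_min lexx.
pose W1 := W `&` v1.
have oW1 : open W1 by apply: openI => //; exact: oN'.
have [|w1 Nw1 hw1] := pN W1 oW1; first by rewrite /W1 setIC.
have [||||||s2 [s20 [v2 [Nv2 v2W hv2]]]] :=
    sr (W1 `&` w1) w1 (lower s C).
- by apply: openI => //; exact: oN.
- by rewrite setIC; exact: hw1.
- by move=> x [].
- by [].
- exact: open_lower.
- rewrite -subset0 => x [w1x [u [Nu hu] ux]].
  have [] := hw1 (w1 `&` u); [by apply: mN => //; exists x|by move=> y []|].
  move=> y [[_ uy] [_ v1y]].
  have : (u `&` v1) y by [].
  by rewrite hu // => z /sphi1.
move: v2W => [z [v2z [[Wz v1z] w1z]]].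
have m0 : 0 < Num.min s s2 by rewrite lt_min s20; case/andP: s01 => ->.
exists (Num.min s s2 / 4); split; first by rewrite divr_gt0.
exists (v1 `&` v2); split.
- by apply: mN' => //; [exact: NN'|exists z].
- by exists z.
move=> x [/sphi1 v1x /hv2 v2x].
have := transfer_ub x C s01.
have : Num.min s s2 <= Num.min s (r x (lower s C)).
  by rewrite le_min; apply/andP; split; rewrite ge_min ?lexx // (ltW v2x) orbT.
have : Num.min s s2 <= s by rewrite ge_min lexx.
by rewrite lt_min => h1 h2 h3; apply/andP; split; lra.
Qed.

End Refinement.

(** * Gluing metrics along a tower of families *)

Section WellOrder.
Context {T : eqType}.
Variable le : rel T.
Hypothesis wo : well_order le.

Definition below (a : T) : set T := [set b | le b a /\ b != a].
Definition upto (a : T) : set T := [set b | le b a].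
Definition initial (J : set T) := forall a b, J a -> le b a -> J b.

Lemma wo_le_total : total le.
Proof.
move=> a b; have [|z [[+ lbz] _]] := wo (A := [pred x | (x == a) || (x == b)]).
  by exists a; rewrite inE eqxx.
rewrite inE => /orP [] /eqP E; rewrite E in lbz.
  by rewrite (lbz b) // inE eqxx orbT.
by rewrite (lbz a) ?orbT // inE eqxx.
Qed.

Lemma wo_le_refl a : le a a.
Proof. by have := wo_le_total a a; rewrite orbb. Qed.

Lemma wo_le_anti a b : le a b -> le b a -> a = b.
Proof.
move=> ab ba.
have [|z [_ zuniq]] := wo (A := [pred x | (x == a) || (x == b)]).
  by exists a; rewrite inE eqxx.
have min_of x : x \in [:: a; b] -> minimum_of le [pred x | (x == a) || (x == b)] x.
  rewrite !inE => xab; split; first by rewrite inE.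
  by move=> y; rewrite inE => /orP [] /eqP ->; case/orP: xab => /eqP -> //;
    exact: wo_le_refl.
have za : z = a by apply: zuniq; apply: min_of; rewrite !inE eqxx.
have zb : z = b by apply: zuniq; apply: min_of; rewrite !inE eqxx orbT.
by rewrite -za.
Qed.

Lemma wo_le_trans b a c : le a b -> le b c -> le a c.
Proof.
move=> ab bc.
have [|z [[+ lbz] _]] := wo (A := [pred x | [|| x == a, x == b | x == c]]).
  by exists a; rewrite inE eqxx.
rewrite inE => /or3P [] /eqP E; rewrite E in lbz.
- by apply: lbz; rewrite inE eqxx !orbT.
- have /(wo_le_anti ab) -> : le b a by apply: lbz; rewrite inE eqxx.
  exact: bc.
- have /(wo_le_anti bc) <- : le c b by apply: lbz; rewrite inE eqxx orbT.
  by [].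
Qed.

Lemma below_wf : well_founded (fun b a => below a b).
Proof.
suff h a : Acc (fun b a => below a b) a by [].
apply: contrapT => na.
pose nA := [pred x | `[< ~ Acc (fun b a => below a b) x >]].
have [|z [[/asboolP nz lbz] _]] := wo (A := nA).
  by exists a; apply/asboolP; exact: na.
apply: nz.
constructor => b [bz nbz]; apply: contrapT => nb.
have zb : le z b by apply: lbz; apply/asboolP; exact: nb.
by move: nbz; rewrite (wo_le_anti bz zb) eqxx.
Qed.

Lemma initial_below a : initial (below a).
Proof.
move=> b c [ba nba] cb; split; first exact: wo_le_trans cb ba.
by apply: contraNN nba => /eqP E; rewrite E in cb; rewrite (wo_le_anti ba cb).
Qed.

Lemma below_upto a : below a `<=` upto a.
Proof. by move=> b []. Qed.

Lemma upto_initial J b : initial J -> J b -> upto b `<=` J.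
Proof. by move=> iJ Jb c; exact: iJ. Qed.

Lemma below_initial J b : initial J -> J b -> below b `<=` J.
Proof. by move=> iJ Jb c [cb _]; exact: iJ cb. Qed.

Lemma upto_below a b : below a b -> upto b `<=` below a.
Proof. by move=> ba; apply: upto_initial => //; exact: initial_below. Qed.

Lemma wo_trichotomy a b : [\/ below a b, a = b | below b a].
Proof.
have [->|ab] := eqVneq a b; first by constructor 2.
by case/orP: (wo_le_total a b) => h; [constructor 3|constructor 1];
  split; rewrite // eq_sym.
Qed.

(** [M J] is the family generated by [J]. The members of [M (upto b)] appear
    at the stage [b], after those of [M (below b)]. *)
Section Tower.
Context {R : realType} {X : topologicalType}.
Variable M : set T -> set (set X).
Hypothesis M_mono : forall J K, J `<=` K -> M J `<=` M K.
Hypothesis M_chain : forall J w, initial J -> M J w ->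
  M set0 w \/ exists2 b, J b & M (upto b) w.
Hypothesis M_open : forall J w, M J w -> open w.
Hypothesis M_meet : forall J, inter_closed (M J).
Hypothesis M_proj : forall J, projective (M J).

(** The projection [w] of [W] to [M J] is found in such a way that, for all but
    finitely many stages [a], its own projection [u] to [M (below a)] is exact
    and sees everything that [M (upto a)] sees of [w]. *)
Definition traced (J : set T) := forall W, open W -> W !=set0 ->
  exists w (L : seq T), [/\ M J w, forall v, M J v -> v `<=` w -> v `&` W !=set0 &
    forall a, J a -> a \notin L -> exists u, [/\ M (below a) u, w `<=` u &
      forall v, M (upto a) v -> v `&` u !=set0 -> v `&` w !=set0]].

(** If [w0] appears at the stage [b], it already belongs to [M (below a)] for
    [a] above [b]. For [a] below [b], replace [w0] by its intersection with a
    traced projection [w1] of [w0] to [M (below b)]: what [M (below b)] sees of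
    the intersection is exactly [w1]. So each step adds one exceptional stage,
    and by well-foundedness there are finitely many of them. *)
Lemma traced_step J : initial J -> (forall b, J b -> traced (below b)) -> traced J.
Proof.
move=> iJ IH W oW W0; have [w0 Mw0 hw0] := M_proj J oW W0.
have w00 : w0 !=set0.
  by have [x [w0x _]] := hw0 w0 Mw0 (@subset_refl _ _); exists x.
have [Mw|[b Jb Mb]] := M_chain iJ Mw0.
  exists w0, [::]; split=> // a Ja _; exists w0; split=> //.
  exact: M_mono Mw.
have [w1 [L [Mw1 hw1 hL]]] := IH b Jb w0 (M_open Mw0) w00.
have w10 : w1 `&` w0 !=set0 by exact: hw1.
have Mw1b : M (upto b) w1 by apply: M_mono Mw1; exact: below_upto.
have Mww : M (upto b) (w1 `&` w0) by exact: M_meet.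
exists (w1 `&` w0), (b :: L); split.
- by apply: M_mono Mww; exact: upto_initial.
- by move=> v Mv vw; apply: hw0 => // x /vw [].
move=> a Ja; rewrite inE negb_or => /andP [ab aL].
have [ba|E|ab'] := wo_trichotomy a b.
- exists (w1 `&` w0); split=> //; apply: M_mono Mww; exact: upto_below.
- by rewrite E eqxx in ab.
have [u [Mu w1u hu]] := hL a ab' aL.
exists u; split=> //; first by move=> x [/w1u].
move=> v Mv vu; have vw1 := hu v Mv vu.
have Mv' : M (below b) v by apply: M_mono Mv; exact: upto_below.
have [|x [[vx w1x] w0x]] := hw1 (v `&` w1) (M_meet Mv' Mw1 vw1).
  by move=> x [].
by exists x.
Qed.

Lemma all_traced J : initial J -> traced J.
Proof.
move=> iJ; apply: traced_step => // b _.
elim/(well_founded_ind below_wf): b => b IH.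
by apply: traced_step; [exact: initial_below|exact: IH].
Qed.

Lemma stable_dense J W : initial J -> open W -> W !=set0 ->
  exists U (L : seq T), [/\ open U, U !=set0, U `<=` W &
    forall a, J a -> a \notin L -> stable (M (below a)) (M (upto a)) U].
Proof.
move=> iJ oW W0; have [w [L [Mw hw hL]]] := all_traced iJ oW W0.
exists (w `&` W), L; split.
- by apply: openI => //; exact: M_open Mw.
- exact: hw.
- by move=> x [].
move=> a Ja aL x [wx _]; have [u [Mu wu hu]] := hL a Ja aL.
exists u; last exact: wu.
split=> // v Mv vU; apply: contrapT => /eqP/set0P; rewrite setIC => vu.
have vw := hu v Mv vu.
have Mv' : M J v by apply: M_mono Mv; exact: upto_initial.
have [|y [[vy wy] Wy]] := hw _ (M_meet Mv' Mw vw); first by move=> y [].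
by have : (v `&` (w `&` W)) y by []; rewrite vU.
Qed.

Variables (base : X -> set X -> R) (phi : T -> X -> set X -> R).
Hypothesis cptX : compact [set: X].

(** The index [None] stands for the metric of [M set0] from which the gluing
    starts. *)
Definition glued_index (J : set T) : set (option T) :=
  [set i | if i is Some b then J b else True].

Definition glued (corr : T -> X -> set X -> R) (J : set T) :=
  ksup (glued_index J) (fun i => if i is Some b then corr b else base).

(** The value [base] at indices not below [a] is a default; [glued _ (below a)]
    ignores these indices. *)
Definition corr_rec (a : T) (rec : forall b, below a b -> X -> set X -> R) :=
  correction (M (below a)) (M (upto a)) (phi a)
    (glued (fun b => if pselect (below a b) is left h then rec b h else base)
           (below a)).

Definition corr := Fix below_wf (fun _ => X -> set X -> R) corr_rec.

Lemma glued_ext t1 t2 J : (forall b, J b -> t1 b = t2 b) -> glued t1 J = glued t2 J.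
Proof.
move=> h; apply/funext => x; apply/funext => U; rewrite /glued /ksup; congr sup.
by apply: eq_imagel => -[b|] //= Jb; rewrite h.
Qed.

Lemma corrE a : corr a =
  correction (M (below a)) (M (upto a)) (phi a) (glued corr (below a)).
Proof.
rewrite {1}/corr Fix_eq; last first.
  move=> b f g fg; rewrite /corr_rec; congr correction; apply: glued_ext => c bc.
  by case: pselect.
rewrite /corr_rec; congr correction; apply: glued_ext => c bc.
by case: pselect.
Qed.

Definition metrizes (c : X -> set X -> R) (N : set (set X)) :=
  kappa_like c /\ separates c N.

Hypothesis base_ok : metrizes base (M set0).

Lemma glued_ub J i x U : (forall b, J b -> kappa_like (corr b)) ->
  glued_index J i -> (if i is Some b then corr b else base) x U <= glued corr J x U.
Proof.
move=> kcorr; apply: ksup_ub => -[b|] /=; first exact: kcorr.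
by move=> _; exact: base_ok.1.
Qed.

Lemma glued_kappa_like J : initial J ->
  (forall b, J b -> kappa_like (phi b)) ->
  (forall b, J b -> kappa_like (corr b)) -> 
  (forall b, J b -> kappa_like (glued corr (below b))) -> kappa_like (glued corr J).
Proof.
move=> iJ kphi kcorr kst; apply: kappa_like_ksup.
- by exists None.
- by move=> [b|] /= => [/kcorr|_]; [|exact: base_ok.1].
move=> e e0.
exists (fun i U => if i is Some a then stable (M (below a)) (M (upto a)) U
                   else False); split.
- by exists [:: None] => -[a|] //= _ _ x [].
- by move=> [a|] // U V; exact: stableU.
- move=> W oW W0; have [U [L [oU U0 UW hL]]] := stable_dense iJ oW W0.
  exists U, (None :: map Some L); split=> // -[a|] //= Ja.
  rewrite inE /= => aL; apply: hL => //; apply: contraNN aL => aL.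
  by apply/mapP; exists a.
- move=> [a|] // U C x /= Ja oU oC sU UC; rewrite corrE.
  apply: le_trans (_ : glued corr (below a) x U / 2 <= _).
    apply: correction_stable => //; [exact: kphi|exact: kst|].
    by move=> u; exact: M_open.
  rewrite -[leLHS]addr0 lerD ?(ltW e0) // ler_pM2r ?invr_gt0 //.
  apply: ksup_le => [|i Di]; first by exists None.
  by apply: glued_ub => //; case: i Di => //= b; exact: below_initial.
Qed.

Lemma glued_separates J : initial J ->
  (forall b, J b -> metrizes (corr b) (M (upto b))) -> separates (glued corr J) (M J).
Proof.
move=> iJ mcorr W w C oW W0 Ww Mw oC wC.
have kcorr b : J b -> kappa_like (corr b) by move=> /mcorr [].
have [M0w|[b Jb Mbw]] := M_chain iJ Mw.
  have [s [s0 [v [Mv vW hv]]]] := base_ok.2 W w C oW W0 Ww M0w oC wC.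
  exists s; split=> //; exists v; split=> //; first exact: M_mono Mv.
  by move=> x /hv /lt_le_trans; apply; exact: (glued_ub (i := None)).
have [s [s0 [v [Mv vW hv]]]] := (mcorr b Jb).2 W w C oW W0 Ww Mbw oC wC.
exists s; split=> //; exists v; split=> //.
  by apply: M_mono Mv; exact: upto_initial.
by move=> x /hv /lt_le_trans; apply; exact: (glued_ub (i := Some b)).
Qed.

Lemma corr_metrizes J b : initial J -> J b ->
  (forall b, J b -> metrizes (phi b) (M (upto b))) ->
  metrizes (corr b) (M (upto b)) /\ kappa_like (glued corr (below b)).
Proof.
move=> iJ + mphi; elim/(well_founded_ind below_wf): b => b IH Jb.
have IH' c : below b c -> metrizes (corr c) (M (upto c)) /\ kappa_like (glued corr (below c)).
  by move=> cb; apply: IH => //; exact: below_initial cb.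
have kst : kappa_like (glued corr (below b)).
  apply: glued_kappa_like; first exact: initial_below.
  - by move=> c cb; apply: (mphi _ _).1; exact: below_initial cb.
  - by move=> c /IH' [[]].
  - by move=> c /IH' [].
split=> //; rewrite corrE; split.
  apply: kappa_like_correction => //; [exact: (mphi _ Jb).1|..].
  by move=> u; exact: M_open.
apply: correction_separates => //.
- by move=> u; exact: M_open.
- by move=> u; exact: M_open.
- by apply: M_mono; exact: below_upto.
- exact: (mphi _ Jb).2.
- apply: glued_separates; first exact: initial_below.
  by move=> c /IH' [].
Qed.

Lemma tower_metrizes J : initial J ->
  (forall b, J b -> metrizes (phi b) (M (upto b))) ->
  metrizes (glued corr J) (M J).
Proof.
move=> iJ mphi; have h b := corr_metrizes (b := b) iJ ^~ mphi.
split.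
  apply: glued_kappa_like => // b Jb.
  - exact: (mphi _ Jb).1.
  - exact: (h b Jb).1.1.
  - exact: (h b Jb).2.
by apply: glued_separates => // b Jb; exact: (h b Jb).1.
Qed.

End Tower.
End WellOrder.

(** * Cozero sets *)

Section Cozero.
Context {R : realType} {X : topologicalType}.

Definition bump_of (W : set X) (f : X -> R) :=
  [/\ continuous f, forall x, 0 <= f x <= 1 & W = [set x | 0 < f x]].

Definition cozero (W : set X) := W !=set0 /\ exists f, bump_of W f.

Definition bump (W : set X) : X -> R :=
  if pselect (exists f, bump_of W f) is left h then projT1 (cid h) else fun=> 0.

Lemma bumpP W : cozero W -> bump_of W (bump W).
Proof.
by move=> [_ h]; rewrite /bump; case: pselect => // h'; exact: projT2 (cid h').
Qed.

Lemma cozero_open W : cozero W -> open W.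
Proof.
by move=> /bumpP [/continuous_rays cf _ ->]; exact: (cf 0).1.
Qed.

Lemma cozeroI A B : cozero A -> cozero B -> A `&` B !=set0 -> cozero (A `&` B).
Proof.
move=> /bumpP [cf f01 fA] /bumpP [cg g01 gB] AB; split=> //.
exists (bump A \min bump B); split.
- by move=> x; apply: continuous_min; [exact: cf|exact: cg].
- move=> x /=; have /andP [f0 f1] := f01 x; have /andP [g0 g1] := g01 x.
  by rewrite le_min f0 g0 ge_min f1.
- rewrite {1}fA {1}gB; apply/seteqP; split=> x /=; rewrite lt_min.
    by move=> [-> ->].
  by move=> /andP [].
Qed.

(** The values of [bump W] on a level are bounded below, which gives the uniform
    bound in [separates]. *)
Definition level (k : nat) (W : set X) : set X :=
  [set x | k.+1%:R^-1 < bump W x].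

Lemma cozero_level k W : cozero W -> level k W !=set0 -> cozero (level k W).
Proof.
move=> /bumpP [cf f01 fW] l0; split=> //.
exists ((fun x => bump W x - k.+1%:R^-1) \max (fun=> 0)); split.
- move=> x; apply: continuous_max; last exact: cst_continuous.
  by apply: cvgB; [exact: cf|exact: cvg_cst].
- move=> x /=; have /andP [f0 f1] := f01 x.
  rewrite le_max lexx orbT ge_max ler01 andbT lerBlDr (le_trans f1) // lerDl.
  by rewrite invr_ge0 ler0n.
- by apply/seteqP; split=> x; rewrite /level /= lt_max ltxx orbF subr_gt0.
Qed.

Lemma cozero_sub (W : set X) :
  completely_regular_space X -> open W -> W !=set0 -> exists2 V, cozero V & V `<=` W.
Proof.
move=> crX oW [a Wa].
have clW : closed (~` W) by rewrite closedC.
have /(uniform_separatorP (R := R)) [f [cf f01 fa fW]] : uniform_separator [set a] (~` W).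
  by apply: crX => //; exact.
have fa0 : f a = 0 by apply: fa; exists a.
have ff x : 0 <= f x <= 1.
  by have /= := f01 (f x) (ex_intro2 _ _ x I erefl); rewrite in_itv.
exists [set x | 0 < 1 - f x].
  split; first by exists a => /=; rewrite fa0 subr0.
  exists (fun x => 1 - f x); split=> //.
    by move=> x; apply: cvgB; [exact: cvg_cst|exact: cf].
  by move=> x; have /andP [? ?] := ff x; apply/andP; split; lra.
move=> x /= fx; apply: contrapT => nWx.
have fx1 : f x = 1 by apply: fW; exists x.
by move: fx; rewrite fx1 subrr ltxx.
Qed.

(** A cozero set inside [W], to turn moves of player I into cozero sets. *)
Definition shrink (W : set X) : set X :=
  if pselect (exists2 V, cozero V & V `<=` W) is left h then s2val (cid2 h)
  else set0.

Lemma shrinkP W : shrink W !=set0 -> cozero (shrink W) /\ shrink W `<=` W.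
Proof.
rewrite /shrink; case: pselect => [h _|_ [x []]].
by split; [exact: s2valP (cid2 h)|exact: s2valP' (cid2 h)].
Qed.

Lemma shrink_neq0 W : completely_regular_space X -> open W -> W !=set0 ->
  shrink W !=set0.
Proof.
move=> crX oW W0; rewrite /shrink; case: pselect => [h|[]].
  by have [] := s2valP (cid2 h).
exact: cozero_sub.
Qed.

End Cozero.

(** * Metrics for countable families *)

Section CountableFamilies.
Context {R : realType} {X : topologicalType}.

Definition bump_gap (w : R) (W : set X) (x : X) (U : set X) : R :=
  if `[< W `&` U = set0 >] then w * bump W x else 0.

Lemma kappa_like_bump_gap w (W : set X) : 0 <= w <= 1 -> @cozero R X W ->
  kappa_like (bump_gap w W).
Proof.
move=> /andP [w0 w1] cW; have [cf f01 fW] := bumpP cW.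
have oW := cozero_open cW.
have c0 x U : 0 <= bump_gap w W x U.
  rewrite /bump_gap; case: ifP => // _; rewrite mulr_ge0 //.
  by case/andP: (f01 x).
split=> //.
- move=> x U; rewrite /bump_gap; case: ifP => // _.
  by case/andP: (f01 x) => f0 f1; rewrite -[1]mulr1 ler_pM.
- move=> U V oU oV UV x; have := c0 x U.
  rewrite /bump_gap; case: asboolP => // WU; case: asboolP => // WV _.
  case: WU; rewrite -subset0 => y [Wy Uy].
  have [|z [Wz Vz]] := closure_meets (A := V) oW; first by exists y; split=> //; exact: UV.
  by have : (W `&` V) z by []; rewrite WV.
- move=> U oU; apply/continuous_rays; rewrite /bump_gap; case: asboolP => _ x.
    by apply: cvgM; [exact: cvg_cst|exact: cf].
  exact: cvg_cst.
- move=> UU [[V0 VV0] _] oUU x e e0; rewrite {2}/bump_gap; case: asboolP => h.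
    exists V0 => //; rewrite /bump_gap; case: asboolP => h'; first by rewrite ltrDl.
    by case: h'; rewrite -subset0 -h => y [Wy Vy]; split=> //; exists V0.
  have [y [Wy [V VV Vy]]] : W `&` \bigcup_(U in UU) U !=set0.
    by apply: contrapT => /nonemptyPn.
  exists V => //; rewrite /bump_gap; case: asboolP => h'; last by rewrite add0r.
  by have : (W `&` V) y by []; rewrite h'.
- move=> U x oU Ux; rewrite /bump_gap; case: asboolP => // WU.
  have nWx : ~ W x by move=> Wx; have : (W `&` U) x by []; rewrite WU.
  suff -> : bump W x = 0 :> R by rewrite mulr0.
  apply/eqP; rewrite eq_le; have /andP [-> _] := f01 x; rewrite andbT leNgt.
  by apply/negP => fx; apply: nWx; rewrite fW.
Qed.

(** The weights [1/(n+1)] tend to zero, so for each error [e] only finitely many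
    indices count, for every open set. *)
Lemma countable_metrizes (N : set (set X)) (e : nat -> set X) :
  N !=set0 -> N `<=` range e -> N `<=` @cozero R X ->
  (forall k w, N w -> level (R := R) k w !=set0 -> N (level (R := R) k w)) ->
  exists c : X -> set X -> R, metrizes c N.
Proof.
move=> N0 Ne Nc Nl.
pose D : set nat := [set n | N (e n)].
pose c n := bump_gap n.+1%:R^-1 (e n).
have w01 n : 0 <= (n.+1%:R^-1 : R) <= 1.
  by rewrite invr_ge0 ler0n /= invf_le1 ?ltr0n // ler1n.
have kc n : D n -> kappa_like (c n).
  by move=> Dn; apply: kappa_like_bump_gap => //; exact: Nc.
have D0 : D !=set0.
  by have [w Nw] := N0; have [n _ en] := Ne _ Nw; exists n; rewrite /D /= en.
exists (ksup D c); split.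
  apply: kappa_like_ksup => // d d0.
  exists (fun n _ => n.+1%:R^-1 <= d).
  have [K hK] : exists K, forall n, n \notin iota 0 K -> n.+1%:R^-1 <= d.
    exists (Num.bound d^-1) => n; rewrite mem_iota /= add0n -leqNgt => Kn.
    rewrite invf_ple ?posrE ?ltr0n //.
    apply: le_trans (ltW (archi_boundP _)) _; first by rewrite invr_ge0 ltW.
    by rewrite ler_nat (leq_trans Kn).
  split=> //.
  - by exists (iota 0 K) => n _; exact: hK.
  - move=> W oW W0; exists W, (iota 0 K); split=> // n _; exact: hK.
  - move=> n U C x Dn oU oC nd UC; apply: le_trans (_ : d <= _); last first.
      by rewrite lerDr divr_ge0 //; exact: ksup_ge0.
    apply: le_trans nd; rewrite /c /bump_gap; have /andP [n0 n1] := w01 n.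
    case: ifP => // _; have [_ /(_ x) /andP [f0 f1] _] := bumpP (Nc _ Dn).
    by rewrite -[leRHS]mulr1 ler_pM.
move=> W w C oW W0 Ww Nw oC wC.
have [x Wx] := W0; have [n _ en] := Ne _ Nw.
have [_ _ wE] := bumpP (Nc _ Nw).
have fx : 0 < bump (R := R) w x by move: (Ww _ Wx); rewrite {1}wE.
pose k := Num.bound (bump (R := R) w x)^-1.
have lx : level (R := R) k w x.
  rewrite /level /= invf_plt ?posrE ?ltr0n //.
  apply: lt_le_trans (archi_boundP _) _; first by rewrite invr_ge0 ltW.
  by rewrite ler_nat.
exists (n.+1%:R^-1 * k.+1%:R^-1); split.
  by rewrite mulr_gt0 // invr_gt0 ltr0n.
exists (level (R := R) k w); split.
- by apply: Nl => //; exists x.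
- by exists x.
move=> y ly; apply: lt_le_trans (_ : c n y C <= _); last first.
  by apply: ksup_ub => //; rewrite /D /= en.
rewrite /c /bump_gap en; case: asboolP => // _.
by rewrite ltr_pM2l // invr_gt0 ltr0n.
Qed.

End CountableFamilies.

(** * Families closed under a winning strategy *)

Section Strategy.
Context {R : realType} {X : topologicalType}.
Hypotheses (cptX : compact [set: X]) (crX : completely_regular_space X).
Variable sigma : seq (set X) -> set X.
Hypothesis sigma_legal : forall s : seq (set X),
  (forall U : set X, U \in s -> open U /\ U !=set0) ->
  open (sigma s) /\ sigma s !=set0.
Hypothesis sigma_wins : forall U : nat -> set X,
  (forall k, open (U k) /\ U k !=set0) ->
  (forall k, U k `<=` sigma (mkseq U k)) -> dense (\bigcup_k U k).

Local Notation cozero := (@cozero R X).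

(** The three kinds of operations are put into a single sequence indexed by
    [k], so that terms built from them can be encoded by trees. *)
Definition op (k : nat) (s : seq (set X)) : set X :=
  match k, s with
  | 0%N, _ => shrink (R := R) (sigma s)
  | 1%N, [:: A; B] => A `&` B
  | k'.+2, [:: A] => level (R := R) k' A
  | _, _ => set0
  end.

Definition op_closed (N : set (set X)) :=
  forall k s, (forall U, U \in s -> N U) -> op k s !=set0 -> N (op k s).

Definition generated (S : set (set X)) : set (set X) :=
  [set w | forall N, S `&` cozero `<=` N -> op_closed N -> N w].

Lemma generated_closed S : op_closed (generated S).
Proof.
by move=> k s hs s0 N SN Ncl; apply: (Ncl k s) => // U /hs; apply.
Qed.

Lemma generated_sub S w : S w -> cozero w -> generated S w.
Proof. by move=> Sw cw N SN _; apply: SN. Qed.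

Lemma generated_min S N : S `&` cozero `<=` N -> op_closed N -> generated S `<=` N.
Proof. by move=> SN Ncl w; apply. Qed.

Lemma generated_mono S S' : S `<=` S' -> generated S `<=` generated S'.
Proof.
move=> SS'; apply: generated_min; last exact: generated_closed.
by move=> w [/SS' Sw cw]; exact: generated_sub.
Qed.

Lemma op_closed_cozero : op_closed cozero.
Proof.
move=> [|[|k]] s hs; first by move=> /shrinkP [].
  case: s hs => [|A [|B [|? ?]]] /= hs; try by case.
  by apply: cozeroI; apply: hs; rewrite !inE eqxx ?orbT.
case: s hs => [|A [|? ?]] /= hs; try by case.
by apply: cozero_level; apply: hs; rewrite inE.
Qed.

Lemma generated_cozero S : generated S `<=` cozero.
Proof. by apply: generated_min; [move=> w []|exact: op_closed_cozero]. Qed.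

Lemma op0_neq0 s : (forall U, U \in s -> cozero U) -> op 0 s !=set0.
Proof.
move=> hs; have [|oS S0] := @sigma_legal s; last exact: shrink_neq0.
by move=> U /hs cU; split; [exact: cozero_open cU|have [] := cU].
Qed.

(** Suppose that below every [w] in [N] there is [f w] in [N] disjoint from
    [W]. Player II answers each move [w] by [f w]; all moves stay in [N], and
    the union of the answers misses [W], against the strategy being winning. *)
Lemma op_closed_proj N : N `<=` cozero -> op_closed N -> projective N.
Proof.
move=> Nc Ncl W oW W0; apply: contrapT => hN.
have /choice [f hf] : forall w, exists v, N w -> [/\ N v, v `<=` w & v `&` W = set0].
  move=> w; apply: contrapT => /forallNP hw; apply: hN.
  have Nw : N w by apply: contrapT => nNw; apply: (hw w) => /nNw.
  exists w => // v Nv vw; apply: contrapT => /nonemptyPn vW.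
  by apply: (hw v).
pose hist n := iter n (fun s => rcons s (f (op 0 s))) [::].
pose U n := f (op 0 (hist n)).
have histE n : mkseq U n = hist n.
  by elim: n => // n IH; rewrite mkseqS IH.
have Nhist n A : A \in hist n -> N A.
  elim: n A => // n IH A; rewrite mem_rcons inE => /orP [/eqP ->|]; last exact: IH.
  have Nop : N (op 0 (hist n)).
    by apply: Ncl => //; apply: op0_neq0 => B /IH /Nc.
  by have [] := hf _ Nop.
have Nop n : N (op 0 (hist n)).
  by apply: Ncl => [A /Nhist //|]; apply: op0_neq0 => B /Nhist /Nc.
have [|n|x [Wx [n _ Ux]]] := sigma_wins (U := U) _ _ W0 oW.
- move=> n; have [/Nc cU _ _] := hf _ (Nop n).
  by split; [exact: cozero_open cU|have [] := cU].
- rewrite histE; have [_ Uop _] := hf _ (Nop n).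
  apply: subset_trans Uop _; apply: (shrinkP _).2.
  by have [] := Nc _ (Nop n).
have [_ _ UW] := hf _ (Nop n).
by have : (f (op 0 (hist n)) `&` W) x by []; rewrite UW.
Qed.

Lemma op_closed_inter N : op_closed N -> inter_closed N.
Proof.
move=> Ncl A B NA NB AB; apply: (Ncl 1%N [:: A; B]) => //.
by move=> U; rewrite !inE => /orP [] /eqP ->.
Qed.

(** Members of a generated family are values of terms with leaves in [F]. *)
Fixpoint eval (F : seq (set X)) (t : GenTree.tree nat) : set X :=
  match t with
  | GenTree.Leaf n => nth set0 F n
  | GenTree.Node k s => op k (map (eval F) s)
  end.

Lemma generated_countable (F : seq (set X)) :
  exists e : nat -> set X, generated [set b | b \in F] `<=` range e.
Proof.
exists (fun n => if unpickle n is Some t then eval F t else set0).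
suff h : generated [set b | b \in F] `<=` range (eval F).
  by move=> w /h [t _ <-]; exists (pickle t) => //; rewrite pickleK.
apply: generated_min => [w [wF _]|k s hs _].
  by exists (GenTree.Leaf (index w F)) => //=; rewrite nth_index.
suff [ts ->] : exists ts, s = map (eval F) ts by exists (GenTree.Node k ts).
elim: s hs => [|A s IH] hs; first by exists [::].
have [|ts ->] := IH; first by move=> U Us; apply: hs; rewrite inE Us orbT.
by have [t _ <-] := hs A (mem_head _ _); exists (t :: ts).
Qed.

Definition layer (F : seq (set X)) (J : set (set X)) : set (set X) :=
  generated [set b | b \in F \/ J b].

Lemma layer_mono F J K : J `<=` K -> layer F J `<=` layer F K.
Proof. by move=> JK; apply: generated_mono => b [|/JK]; [left|right]. Qed.

Lemma layer_base F : exists c : X -> set X -> R, metrizes c (layer F set0).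
Proof.
have [e he] := generated_countable F.
have E : layer F set0 = generated [set b | b \in F].
  by congr generated; apply/seteqP; split=> b /=; [case|left].
rewrite E; apply: (countable_metrizes _ he (@generated_cozero _)).
- exists (op 0 [::]); apply: generated_closed => //; exact: op0_neq0.
- move=> k w Nw; apply: (generated_closed (k := k.+2) (s := [:: w])) => U.
  by rewrite inE => /eqP ->.
Qed.

Variable le : rel (set X).
Hypothesis wo : well_order le.

(** An operation has finitely many arguments and [le] is total, so the union of
    the families on the right is closed under the operations. *)
Lemma layer_chain F J w : initial le J -> layer F J w ->
  layer F set0 w \/ exists2 b, J b & layer F (upto le b) w.
Proof.
move=> iJ; move: w; pose N w := layer F set0 w \/ exists2 b, J b & layer F (upto le b) w.
apply: (generated_min (N := N)) => [w [[wF|Jw] cw]|k s hs s0].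
- by left; apply: generated_sub => //; left.
- right; exists w => //; apply: generated_sub => //; right; exact: wo_le_refl.
have [h|[b Jb h]] : (forall U, U \in s -> layer F set0 U) \/
    exists2 b, J b & forall U, U \in s -> layer F (upto le b) U.
- elim: s hs {s0} => [|A s IH] hs; first by left.
  have A0 : N A by apply: hs; rewrite mem_head.
  have up0 b : layer F set0 `<=` layer F (upto le b) by apply: layer_mono.
  have upS b c : le b c -> layer F (upto le b) `<=` layer F (upto le c).
    by move=> bc; apply: layer_mono => d db; exact: (wo_le_trans wo) db bc.
  have [|h|[b Jb h]] := IH; first by move=> U Us; apply: hs; rewrite inE Us orbT.
    case: A0 => [A0|[b Jb Ab]].
      by left => U; rewrite inE => /orP [/eqP ->|/h].
    by right; exists b => // U; rewrite inE => /orP [/eqP ->|/h /up0].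
  right; case: A0 => [A0|[c Jc Ac]].
    by exists b => // U; rewrite inE => /orP [/eqP ->|/h //]; exact: up0.
  case/orP: (wo_le_total wo b c) => bc.
    by exists c => // U; rewrite inE => /orP [/eqP ->|/h /(upS _ _ bc)].
  by exists b => // U; rewrite inE => /orP [/eqP ->|/h //]; exact: (upS _ _ bc).
- by left; exact: generated_closed.
- by right; exists b => //; exact: generated_closed.
Qed.

(** A stage is absorbed in the finite set of parameters: this is what makes
    the induction hypothesis for [below le b] apply to [upto le b]. *)
Lemma layer_cons F b : layer (b :: F) (below le b) = layer F (upto le b).
Proof.
congr generated; apply/seteqP; split=> c /=; rewrite inE.
  by move=> [/orP [/eqP ->|]|[? _]]; [right; exact: wo_le_refl|left|right].
move=> [->|cb]; first by left; rewrite orbT.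
by have [->|nb] := eqVneq c b; [left|right].
Qed.

Lemma layer_step J F : initial le J ->
  (forall b, J b -> forall F', exists c : X -> set X -> R,
     metrizes c (layer F' (below le b))) ->
  exists c : X -> set X -> R, metrizes c (layer F J).
Proof.
move=> iJ IH; have [base hbase] := layer_base F.
have /choice [phi hphi] : forall b, exists c : X -> set X -> R,
    J b -> metrizes c (layer F (upto le b)).
  move=> b; have [Jb|nJb] := pselect (J b); last by exists base.
  by have [c hc] := IH b Jb (b :: F); exists c; rewrite -layer_cons.
exists (glued base (corr wo (layer F) base phi) J).
apply: tower_metrizes => //.
- exact: layer_mono.
- exact: layer_chain.
- by move=> K w /generated_cozero /cozero_open.
- by move=> K; apply: op_closed_inter; exact: generated_closed.
- by move=> K; apply: op_closed_proj; [exact: generated_cozero|exact: generated_closed].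
Qed.

Lemma layer_metrizes J F : initial le J ->
  exists c : X -> set X -> R, metrizes c (layer F J).
Proof.
move=> iJ; apply: layer_step => // b _ F'.
elim/(well_founded_ind (below_wf wo)): b F' => b IH F'.
by apply: layer_step; [exact: initial_below|exact: IH].
Qed.

End Strategy.

Lemma I_favorable_metrizes (R : realType) (X : topologicalType) :
  compact [set: X] -> completely_regular_space X -> I_favorable X ->
  exists c : X -> set X -> R, metrizes c (@cozero R X).
Proof.
move=> cptX crX [sigma [legal wins]].
have [le wo] := well_ordering_principle (set X).
have [c [kc sc]] := @layer_metrizes R X cptX crX sigma legal wins le wo setT [::]
  (fun _ _ _ _ => I).
exists c; split=> // W w C oW W0 Ww cw oC wC.
have Lw : layer (R := R) sigma [::] setT w by apply: generated_sub => //; right.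
have [s [s0 [v [Lv vW hv]]]] := sc W w C oW W0 Ww Lw oC wC.
by exists s; split=> //; exists v; split=> //; exact: generated_cozero Lv.
Qed.

(** * The two implications *)

Section Conclusion.
Context {R : realType} {X : topologicalType}.

(** The index type of K4 is an arbitrary type; classically it has a decidable
    equality. *)
Lemma wo_total_Type (T : Type) (le : rel T) : well_order le -> total le.
Proof. exact: (@wo_le_total {classic T} le). Qed.

Lemma metrizes_quasi_kappa (c : X -> set X -> R) :
  completely_regular_space X -> metrizes c (@cozero R X) ->
  is_quasi_kappa_metric (fun x C => c x (interior C)).
Proof.
move=> crX [kc sc].
have oi (C : set X) : open (interior C) by exact: open_interior.
split.
- by move=> x C _; exact: kl_ge0.
- move=> C rC; exists [set x | 0 < c x (interior C)]; split.
  + exact: (kl_cont kc (oi C) 0).1.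
  + move=> x /= cx Cx.
    have [|y [/= cy Cy]] := closure_meets (A := interior C) (kl_cont kc (oi C) 0).1.
      by exists x; split=> //; rewrite rC.
    by move: cy; rewrite (kl_zero kc (oi C) Cy) ltxx.
  + apply: meets_closure => W oW [x [Wx nCx]].
    have oD : open (W `&` ~` C).
      apply: openI => //; rewrite openC -rC; exact: closed_closure.
    have [|w cw wD] := cozero_sub (R := R) crX oD; first by exists x.
    have wC : w `&` interior C = set0.
      by rewrite -subset0 => y [/wD [_ nCy] /interior_subset].
    have [s [s0 [v [_ [y [vy wy]] hv]]]] :=
      sc w w _ (cozero_open cw) cw.1 (@subset_refl _ _) cw (oi C) wC.
    by exists y; split; [have [] := wD _ wy|exact: lt_trans (hv _ vy)].
  + move=> x /=; split=> [->|]; first by rewrite ltxx.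
    by move/negP; rewrite -leNgt => cx; apply/eqP; rewrite eq_le cx kl_ge0.
- by move=> C C' rC rC' CC' x; apply: (kl_antiS x kc) => //; exact: interiorS.
- by move=> C rC; apply/continuous_rays; exact: kl_cont.
- move=> I leI C [i0] wo rC mono x.
  set W := closure (\bigcup_i C i).
  pose UU := [set interior (C i) | i in [set: I]].
  have oUU U : UU U -> open U by move=> [i _ <-].
  have dUU : directed UU.
    split; first by exists (interior (C i0)), i0.
    move=> _ _ [i _ <-] [j _ <-].
    have [h|h] := orP (wo_total_Type wo i j).
      exists (interior (C j)); first by exists j.
      by rewrite subUset; split=> //; apply: interiorS; exact: mono.
    exists (interior (C i)); first by exists i.
    by rewrite subUset; split=> //; apply: interiorS; exact: mono.
  have oU : open (\bigcup_(U in UU) U) by exact: bigcup_open.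
  have WU : interior W `<=` closure (\bigcup_(U in UU) U).
    apply: subset_trans (@interior_subset _ _) _.
    rewrite [X in _ `<=` X](closure_id _).1; last exact: closed_closure.
    apply: closureS => y [i _]; rewrite -rC; apply: closureS => z Ciz.
    by exists (interior (C i)) => //; exists i.
  apply/eqP; rewrite eq_le; apply/andP; split.
    apply: lb_le_inf; first by exists (c x (interior (C i0))), i0.
    move=> _ [i _ <-]; apply: (kl_antiS x kc) => //.
    by apply: interiorS => y Ciy; apply: subset_closure; exists i.
  apply/ler_addgt0Pr => e e0.
  have [_ [i _ <-] /ltW hi] := kl_dir kc dUU oUU x e0.
  apply: le_trans (_ : c x (interior (C i)) <= _).
    by apply: ge_inf; [exists 0 => _ [j _ <-]; exact: kl_ge0|exists i].
  by apply: le_trans hi _; rewrite lerD2r; exact: (kl_anti kc).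
Qed.

Lemma leq_well_order : well_order leq.
Proof.
apply: antisymmetric_well_order; first exact: anti_leq.
move=> A [n An]; have h : exists n, n \in A by exists n.
by case: (ex_minnP h) => m Am lem; exists m; split=> // k; exact: lem.
Qed.

Definition played (s : seq (set X)) : set X :=
  closure [set x | exists2 U, U \in s & U x].

Lemma regclosed_played s : (forall U, U \in s -> open U) -> regclosed (played s).
Proof.
move=> os; apply: closure_open_regclosed; apply: openP => x [U Us Ux].
by exists U; [split=> //; exact: os|move=> y Uy; exists U].
Qed.

Lemma playedS s t : {subset s <= t} -> played s `<=` played t.
Proof. by move=> st; apply: closureS => x [U /st Ut Ux]; exists U. Qed.

Lemma quasi_kappa_dini (rho : X -> set X -> R) (C : nat -> set X) e :
  compact [set: X] -> is_quasi_kappa_metric rho ->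
  (forall n, regclosed (C n)) -> (forall m n, (m <= n)%N -> C m `<=` C n) ->
  regclosed (closure (\bigcup_n C n)) -> 0 < e ->
  exists n, forall x, rho x (C n) <= rho x (closure (\bigcup_n C n)) + e.
Proof.
move=> cptX qk rC mono rG e0; set G := closure _.
have cov x : [set: X] x ->
    \forall y \near x & n \near \oo, rho y (C n) <= rho y G + e.
  move=> _.
  have [||_ [n _ <-] hn] := @inf_lt _ (range (fun n => rho x (C n))) (rho x G + e / 4).
  - by exists (rho x (C 0%N)), 0%N.
  - have <- := qkm_K4 qk (inhabits 0%N) leq_well_order rC mono x.
    by rewrite ltrDl divr_gt0.
  have /continuous_rays cn := qkm_K3 qk (rC n).
  have /continuous_rays cG := qkm_K3 qk rG.
  exists ([set y | rho y (C n) < rho x G + e / 2] `&` [set y | rho x G - e / 2 < rho y G],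
          [set m | (n <= m)%N]).
    split; last exact: nbhs_infty_ge.
    apply: open_nbhs_nbhs; split; first exact: openI (cn _).2 (cG _).1.
    by split=> /=; lra.
  move=> [y m] /= [[h1 h2] nm].
  by have := qkm_K2 qk (rC n) (rC m) (mono _ _ nm) y; lra.
have [n _ hn] := (compact_near_coveringP [set: X]).1 cptX _ \oo _ _ cov.
by exists n => x; apply: (hn n) => /=.
Qed.

(** The least visible [n] stays bounded during a play whose union is not dense,
    so the thresholds [1/(n+1)] that player I uses stay away from zero. *)
Lemma quasi_kappa_I_favorable : compact [set: X] -> [set: X] !=set0 ->
  quasi_kappa_metrizable R X -> I_favorable X.
Proof.
move=> cptX X0 [rho qk].
pose far s n : set X := [set x | n.+1%:R^-1 < rho x (played s)].
pose visible s n := `[< far s n !=set0 >].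
exists (fun s => if pselect (exists n, visible s n) is left h
                 then far s (ex_minn h) else setT); split.
  move=> s hs; case: pselect => [h|_]; last by split; [exact: openT|exact: X0].
  split; last by case: ex_minnP => n /asboolP.
  have rs : regclosed (played s) by apply: regclosed_played => U /hs [].
  exact: ((continuous_rays _).1 (qkm_K3 qk rs) _).1.
move=> U hU play.
pose C n := played (mkseq U n); pose G := closure (\bigcup_n U n).
have rC n : regclosed (C n).
  by apply: regclosed_played => V /mapP [i _ ->]; case: (hU i).
have mono m n : (m <= n)%N -> C m `<=` C n.
  move=> mn; apply: playedS => V /mapP [i]; rewrite mem_iota => /andP [_ im] ->.
  by apply/mapP; exists i => //; rewrite mem_iota /= (leq_trans im).
have GE : closure (\bigcup_n C n) = G.
  apply/seteqP; split.
    rewrite [X in _ `<=` X](closure_id _).1; last exact: closed_closure.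
    apply: closureS => x [n _]; apply: closureS => y [V /mapP [i _ ->] Uy].
    by exists i.
  apply: closureS => x [n _ Ux]; exists n.+1 => //; apply: subset_closure.
  by exists (U n) => //; apply/mapP; exists n => //; rewrite mem_iota add0n leqnn.
have rG : regclosed G.
  by apply: closure_open_regclosed; apply: bigcup_open => i _; case: (hU i).
have [V [oV VG GV hV]] := qkm_K1 qk rG.
move=> W [z Wz] oW; apply: contrapT => nW.
have nGz : ~ G z.
  by move=> Gz; apply: nW; apply: closure_meets => //; exists z.
have [x0 [Vx0 _]] := GV _ nGz W (open_nbhs_nbhs (conj oW Wz)).
have rx0 : 0 < rho x0 G.
  by rewrite lt_neqAle (qkm_ge0 qk x0 rG) andbT eq_sym; apply/eqP => /hV; apply.
pose N := Num.bound (rho x0 G)^-1.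
have N0 : 0 < N.+1%:R^-1 :> R by rewrite invr_gt0 ltr0n.
have Nx0 : N.+1%:R^-1 < rho x0 G.
  rewrite invf_plt ?posrE ?ltr0n //.
  apply: lt_le_trans (archi_boundP _) _; first by rewrite invr_ge0 ltW.
  by rewrite ler_nat.
have N20 : 0 < N.+1%:R^-1 / 2 :> R by rewrite divr_gt0.
have [|k hk] := quasi_kappa_dini cptX qk rC mono _ N20; first by rewrite GE.
have CG : C k `<=` G.
  by rewrite -GE => x Cx; apply: subset_closure; exists k.
have visN : visible (mkseq U k) N.
  apply/asboolP; exists x0; apply: lt_le_trans Nx0 _.
  have h := qkm_K2 qk (rC k) rG CG x0.
  exact: h.
have [_ [y Uy]] := hU k; have := play k _ Uy.
case: pselect => [h|[]]; last by exists N.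
case: ex_minnP => n _ /(_ N visN) nN yn.
have Nn : N.+1%:R^-1 <= n.+1%:R^-1 :> R.
  by rewrite lef_pV2 ?posrE ?ltr0n // ler_nat.
have := hk y; rewrite GE.
have -> : rho y G = 0.
  by apply/hV => /VG; apply; apply: subset_closure; exists k.
rewrite add0r => le_half; have lt_n : n.+1%:R^-1 < rho y (C k) := yn.
have := le_lt_trans Nn (lt_le_trans lt_n le_half).
by rewrite ltNge ler_piMr ?invf_le1 ?ltr0n ?ler1n // ltW.
Qed.

End Conclusion.

Theorem theorem1p4 (R : realType) (X : topologicalType)
    (X_nonempty : [set: X] !=set0)
    (X_tychonoff : tychonoff_space X)
    (X_compact : compact [set: X]) :
  I_favorable X <-> quasi_kappa_metrizable R X.
Proof.
have [_ crX] := X_tychonoff; split; last exact: quasi_kappa_I_favorable.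
move=> /(I_favorable_metrizes R X_compact crX) [c hc].
by exists (fun x C => c x (interior C)); exact: metrizes_quasi_kappa.
Qed.
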